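(* Let $k\ge1$, $\mathbf t=(t_1,\dots,t_k)\in\mathbb Z^k$ with $t_k\neq 0$, let $\mathcal C(X)=X^k-t_1X^{k-1}-\dots-t_k$ and let $\mathbf A$ be the $k\times k$ companion matrix whose rows $1,\dots,k-1$ are the standard basis vectors $e_2,\dots,e_k$ and whose last row is $(t_k,t_{k-1},\dots,t_1)$. Then: (a) For every $n\in\mathbb Z$, the $(i,j)$ entry of $\mathbf A^n$ ($1\le i,j\le k$) equals $(-1)^{k-j}S_{(n-k+i,\,1^{k-j})}$. (b) For every root $\lambda$ of $\mathcal C$ and every $m\in\mathbb Z$, $\lambda^m=\sum_{j=0}^{k-1}(-1)^{k-1-j}S_{(m-k+1,\,1^{k-1-j})}\lambda^j$. (c) For each fixed $(i,j)$, the sequence $x_n=(\mathbf A^n)_{ij}$, $n\in\mathbb Z$, satisfies $x_n=\sum_{l=1}^k t_l x_{n-l}$ for all $n\in\mathbb Z$; in particular $(\mathbf A^n)_{k,k}=F_{k,n}(\mathbf t)$ for all $n\in\mathbb Z$. (d) For every $n\in\mathbb Z$, $\operatorname{tr}(\mathbf A^n)=G_{k,n}(\mathbf t)$, and the sequence $(G_{k,n}(\mathbf t))_{n\in\mathbb Z}$ satisfies the same recursion.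
   Context: Let $\lambda_1,\dots,\lambda_k\in\mathbb C$ be the roots of $\mathcal C$ with multiplicity. Put $e_0=1$, $e_j=(-1)^{j+1}t_j$ for $1\le j\le k$ (these are the elementary symmetric polynomials of the roots) and $e_j=0$ for $j>k$ or $j<0$. The Generalized Fibonacci Polynomials $F_{k,n}(\mathbf t)$, $n\in\mathbb Z$, are defined by $F_{k,0}=1$, $F_{k,-1}=\dots=F_{k,-(k-1)}=0$ and $F_{k,n}=\sum_{j=1}^k t_jF_{k,n-j}$ for all $n\in\mathbb Z$ (extended to negative $n$ using $t_k\ne0$; values in $\mathbb Q$); for $n\ge0$ they equal the complete symmetric polynomials $h_n(\lambda_1,\dots,\lambda_k)$. Write $h_n=F_{k,n}(\mathbf t)$ for all $n\in\mathbb Z$. For $a\in\mathbb Z$ and $b\ge0$ the (isobaric reflect of the) Schur-hook polynomial is $S_{(a,1^b)}=\sum_{i=0}^{b}(-1)^ih_{a+i}e_{b-i}$; for $a\ge1$ this is the Schur polynomial $s_{(a,1^b)}(\lambda_1,\dots,\lambda_k)$ expressed in $\mathbf t$. The Generalized Lucas Polynomials are $G_{k,n}(\mathbf t)=\sum_{i=1}^k\lambda_i^n$ (power sums of the roots), $n\in\mathbb Z$. *)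

(* Defs.v *)
From mathcomp Require Import all_boot all_order all_algebra.
From mathcomp Require Import zify.

Set Implicit Arguments.
Unset Strict Implicit.
Unset Printing Implicit Defensive.

Import Order.TTheory GRing.Theory Num.Theory.
Local Open Scope ring_scope.

(* The vector (t_1, ..., t_k) is the tuple t, so that t_j is the item of t of
   rank j - 1; tc is only meaningful for j >= 1, and tc t j = 0 for j > k. *)
Definition tc (k : nat) (t : k.-tuple int) (j : nat) : int := t`_j.-1.

Definition core_poly (k : nat) (t : k.-tuple int) : {poly int} :=
  'X^k - \sum_(1 <= j < k.+1) tc t j *: 'X^(k - j).

(* Indices start at 0: entry (i, j) is the usual entry (i + 1, j + 1), so the
   last row is i + 1 = k, whose usual (j + 1)-st entry is t_(k - j). *)
Definition companion (k : nat) (t : k.-tuple int) : 'M[rat]_k :=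
  \matrix_(i, j) if i.+1 == k then (tc t (k - j))%:~R
                 else (j == i.+1 :> nat)%:R.

Definition esym (k : nat) (t : k.-tuple int) (j : nat) : rat :=
  if j == 0%N then 1
  else if (j <= k)%N then (-1) ^+ j.+1 * (tc t j)%:~R else 0.

(* Two-sided linear recurrence F_n = t_1 F_(n-1) + ... + t_k F_(n-k), computed
   on windows w with w i = F_(m-i) for i < k (the values w i, i >= k, are
   irrelevant): window_up goes from m to m + 1 and window_down, which solves
   the recurrence for F_(m-k), from m to m - 1. *)
Definition window_up (k : nat) (t : k.-tuple int) (w : nat -> rat) : nat -> rat :=
  fun i => if i is i'.+1 then w i'
           else \sum_(1 <= j < k.+1) (tc t j)%:~R * w j.-1.

Definition window_down (k : nat) (t : k.-tuple int) (w : nat -> rat) :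
    nat -> rat :=
  fun i => if (i.+1 < k)%N then w i.+1
           else (w 0%N - \sum_(1 <= j < k) (tc t j)%:~R * w j) / (tc t k)%:~R.

Definition window0 : nat -> rat := fun i => (i == 0%N)%:R.

Definition gfp_window (k : nat) (t : k.-tuple int) (n : int) : nat -> rat :=
  match n with
  | Posz m => iter m (window_up t) window0
  | Negz m => iter m.+1 (window_down t) window0
  end.

Definition gfp (k : nat) (t : k.-tuple int) (n : int) : rat :=
  gfp_window t n 0%N.

Definition schur_hook (k : nat) (t : k.-tuple int) (a : int) (b : nat) : rat :=
  \sum_(i < b.+1) (-1) ^+ i * gfp t (a + i%:Z) * esym t (b - i).

Definition roots_of (C : fieldType) (k : nat) (t : k.-tuple int)
    (lam : 'I_k -> C) : Prop :=
  map_poly intr (core_poly t) = \prod_(i < k) ('X - (lam i)%:P).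

Definition lucas (C : fieldType) (k : nat) (lam : 'I_k -> C) (n : int) : C :=
  \sum_(i < k) lam i ^ n.

(* gfp satisfies the equations that characterize the generalized Fibonacci
   polynomials. *)
Section GfpSpec.

Variables (k : nat) (t : k.-tuple int).
Hypotheses (k_gt0 : (0 < k)%N) (tk_neq0 : tc t k != 0).

Let tkQ : (tc t k)%:~R != 0 :> rat. Proof. by rewrite intr_eq0. Qed.

Lemma window_upK w i : (i < k)%N -> window_down t (window_up t w) i = w i.
Proof.
move=> ik; rewrite /window_down; case: ltnP => [//|ki].
have -> : i = k.-1 by lia.
apply: (canLR (mulfK tkQ)); rewrite /= big_nat_recr //= addrAC mulrC.
rewrite [X in X + _](_ : _ = 0) ?add0r //; apply/eqP; rewrite subr_eq0.
by apply/eqP/eq_big_nat => -[|j].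
Qed.

Lemma window_downK w i : (i < k)%N -> window_up t (window_down t w) i = w i.
Proof.
case: i => [_|i ik] /=; last by rewrite /window_down ik.
rewrite big_nat_recr //= /window_down prednK // ltnn [X in _ + X]mulrC divfK //.
rewrite addrC; apply: etrans (subrK _ _); congr (_ + _); apply: eq_big_nat.
by move=> [|j] // /andP[_ jk] /=; rewrite jk.
Qed.

Lemma gfp_windowS n i : (i < k)%N ->
  gfp_window t (n + 1) i = window_up t (gfp_window t n) i.
Proof.
move=> ik; case: n => [m|[|m]]; first by rewrite -PoszD addn1.
  by rewrite /= window_downK.
have -> : Negz m.+1 + 1 = Negz m by lia.
by rewrite /= -/(iter m.+1 _ _) window_downK.
Qed.

Lemma gfp_windowE n i : (i < k)%N -> gfp_window t n i = gfp t (n - i%:Z).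
Proof.
elim: i n => [|i IHi] n ik; first by rewrite subr0.
have -> : n = (n - 1) + 1 by rewrite subrK.
rewrite gfp_windowS //= IHi ?(ltnW ik) //; congr gfp; lia.
Qed.

Lemma gfp0 : gfp t 0 = 1. Proof. by []. Qed.

Lemma gfpN j : (0 < j < k)%N -> gfp t (- j%:Z) = 0.
Proof.
case/andP=> j0 jk; rewrite -[- _]add0r -gfp_windowE //.
by rewrite /= /window0 eqn0Ngt j0.
Qed.

Lemma gfp_rec n :
  gfp t n = \sum_(1 <= j < k.+1) (tc t j)%:~R * gfp t (n - j%:Z).
Proof.
rewrite -{1}(subrK 1 n) /gfp gfp_windowS //=.
apply: eq_big_nat => -[//|j] /andP[_ jk].
by rewrite gfp_windowE //; congr (_ * gfp t _); lia.
Qed.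

End GfpSpec.

(* Negative powers of the companion matrix are genuine powers of its inverse. *)
Lemma companion_unit (k : nat) (t : k.-tuple int) :
  tc t k != 0 -> companion t \in unitmx.
Proof.
case: k t => [|k] t tk0; first by rewrite unitmxE det_mx00 unitr1.
rewrite -unitmx_tr -row_free_unit; apply/inj_row_free => v vA0.
have Aj i : \sum_j v 0 j * companion t i j = 0.
  move/rowP/(_ i): vA0; rewrite !mxE => {2}<-.
  by apply: eq_bigr => j _; rewrite !mxE.
have vS (j : 'I_k.+1) : (0 < j)%N -> v 0 j = 0.
  move=> j0; have jk : (j.-1 < k.+1)%N by case: j j0 => /= j; lia.
  have /eqP := Aj (Ordinal jk); rewrite (bigD1 j) //= big1 => [|l lj].
    by rewrite mxE /= prednK // ltn_eqF ?ltn_ord // eqxx mulr1 addr0 => /eqP.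
  rewrite mxE /= prednK // ltn_eqF ?ltn_ord //.
  by rewrite (negPf (lj : _ != _ :> nat)) mulr0.
apply/rowP => j; rewrite mxE.
case: (posnP j) => [j0|/vS //]; have -> : j = ord0 by apply: val_inj.
have /eqP := Aj ord_max; rewrite big_ord_recl /= big1 => [|l _].
  by rewrite mxE eqxx subn0 addr0 mulf_eq0 intr_eq0 (negPf tk0) orbF => /eqP.
by rewrite vS ?mul0r.
Qed.

Lemma roots_of_exists (C : closedFieldType) (k : nat) (t : k.-tuple int) :
  exists lam : 'I_k -> C, roots_of t lam.
Proof.
pose q : {poly int} := \sum_(1 <= j < k.+1) tc t j *: 'X^(k - j).
have sq : (size (- q)%R < size ('X^k : {poly int})%R)%N.
  rewrite size_polyN size_polyXn ltnS; apply: leq_trans (size_sum _ _ _) _.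
  apply/bigmax_leqP_seq => j; rewrite mem_index_iota => /andP[j1 jk] _.
  by apply: leq_trans (size_scale_leq _ _) _; rewrite size_polyXn; lia.
have monC : core_poly t \is monic.
  by rewrite monicE lead_coefDl // lead_coefXn.
have szC : size (core_poly t) = k.+1 by rewrite size_polyDl // size_polyXn.
pose p : {poly C} := map_poly intr (core_poly t).
have monp : p \is monic by rewrite monic_map.
have [r pE] := closed_field_poly_normal p.
have szr : size r = k.
  have := congr1 (fun u : {poly C} => size u) pE.
  rewrite (monicP monp) scale1r size_prod_XsubC.
  by rewrite size_map_poly_id0 ?szC ?(monicP monC) ?oner_eq0 // => -[].
exists (fun i => r`_i); rewrite /roots_of -/p pE (monicP monp) scale1r.
by rewrite (big_nth 0) szr big_mkord.
Qed.

(* Main.v *)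
Require Import Defs.
From mathcomp Require Import all_boot all_order all_algebra.
From mathcomp Require Import reals.
From mathcomp Require Import complex.
From mathcomp Require Import zify ring.

(* The signed hooks (-1)^b S_(a,1^b) equal
   h_(a+b) - t_1 h_(a+b-1) - ... - t_b h_a, so they satisfy the recurrence in a,
   and this says exactly that the matrices of (a) are multiplied by A when n
   increases by 1; at n = 0 they are the identity because h vanishes on
   -(k-1), ..., -1.  Part (b) is the first row of A^m v = lambda^m v for
   v = (1, lambda, ..., lambda^(k-1)).  For the trace, the Newton polynomials
   prod_(l < i) (X - lambda_l) give a unitriangular change of basis that makes
   A bidiagonal with diagonal the roots; this settles n >= 0, and the two-sided
   recurrence with t_k != 0 propagates the identity to negative n. *)

Set Implicit Arguments.
Unset Strict Implicit.
Unset Printing Implicit Defensive.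

Import Order.TTheory GRing.Theory Num.Theory.
Local Open Scope ring_scope.

(** * Two-sided linear recurrences, integer powers and rows of the companion matrix *)

Definition core_rec (F : pzRingType) (k : nat) (t : k.-tuple int)
    (x : int -> F) : Prop :=
  forall n, x n = \sum_(1 <= l < k.+1) (tc t l)%:~R * x (n - l%:Z).

Lemma core_rec_sum (F : comPzRingType) (k : nat) (t : k.-tuple int) (I : Type)
    (r : seq I) (c : I -> F) (x : I -> int -> F) :
  (forall i, core_rec t (x i)) ->
  core_rec t (fun n => \sum_(i <- r) c i * x i n).
Proof.
move=> xrec n; under [RHS]eq_bigr do rewrite mulr_sumr.
rewrite exchange_big; apply: eq_bigr => i _ /=.
by rewrite {1}xrec mulr_sumr; apply: eq_bigr => l _; rewrite mulrCA.
Qed.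

Lemma core_rec_shift (F : pzRingType) (k : nat) (t : k.-tuple int)
    (x : int -> F) (a : int) :
  core_rec t x -> core_rec t (fun n => x (n + a)).
Proof.
by move=> xrec n; rewrite xrec; apply: eq_bigr => l _; rewrite addrAC.
Qed.

(** As t_(k+1) is nonzero, the recurrence can be solved for its oldest term, so zeros spread
    downwards. This carries identities from n >= 0 to all integers. *)
Lemma core_rec_eq0 (F : idomainType) (k : nat) (t : k.+1.-tuple int)
    (x : int -> F) :
  (tc t k.+1)%:~R != 0 :> F -> core_rec t x ->
  (forall n : nat, x n = 0) -> forall n, x n = 0.
Proof.
move=> tk0 xrec x0 n.
suff xN (N : nat) m : - N%:Z <= m -> x m = 0 by apply: (xN `|n|%N); lia.
elim: N m => [|N IHN] m mN; first by case: m mN.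
have [/IHN //|mN'] := leP (- N%:Z) m.
(* Here m = -N-1: in the recurrence at m + k + 1 every term except t_(k+1) x_m has index at least
   -N. *)
have /esym/eqP := xrec (m + k.+1%:Z); rewrite IHN; last by lia.
rewrite big_nat_recr //= addrK big_nat big1 ?add0r => [|l /andP[_ lk]].
  by rewrite mulf_eq0 (negPf tk0) => /eqP.
by rewrite IHN ?mulr0 //; lia.
Qed.

Lemma exprz_uniq (R : unitRingType) (a : R) (x : int -> R) :
  a \is a GRing.unit -> x 0 = 1 -> (forall n, x (n + 1) = a * x n) ->
  forall n, x n = a ^ n.
Proof.
move=> ua x0 xS; elim/int_ind => [|n IHn|n IHn]; first by rewrite expr0z.
  by rewrite -addn1 PoszD xS IHn addrC exprzDr.
apply: (mulrI ua); rewrite -xS (_ : - n.+1%:Z + 1 = - n%:Z) ?IHn; last by lia.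
by rewrite (_ : - n%:Z = 1 - n.+1%:Z) ?exprzDr ?expr1z //; lia.
Qed.

(** The morphism [f] is kept general to serve both the rational matrix ([idfun]) and its image in a
    field containing roots ([ratr]). *)
Lemma companion_row_sum (F : pzRingType) (f : {rmorphism rat -> F}) (k : nat)
    (t : k.+1.-tuple int) (x : nat -> F) (i : 'I_k.+1) :
  \sum_j f (companion t i j) * x j =
  if i.+1 == k.+1 then \sum_(1 <= l < k.+2) (tc t l)%:~R * x (k.+1 - l)%N
  else x i.+1.
Proof.
under eq_bigr do rewrite mxE; case: ifPn => [_|ik].
  rewrite big_add1 big_mkord [LHS](reindex_inj rev_ord_inj) /=.
  apply: eq_bigr => j _; rewrite rmorph_int subSS.
  by congr ((tc t _)%:~R * _); have := ltn_ord j; lia.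
have ik' : (i.+1 < k.+1)%N by have := ltn_ord i; lia.
rewrite (bigD1 (Ordinal ik')) //= eqxx rmorph1 mul1r big1 ?addr0 // => j ji.
by rewrite (negPf (ji : _ != _ :> nat)) rmorph0 mul0r.
Qed.

(** * Signed hooks as entries of the powers *)

Section HookEntries.

Variables (k : nat) (t : k.+1.-tuple int).

Let h := gfp t.

(** The signs (-1)^b, (-1)^i and that of e_(b-i) multiply to -1 for i < b and to 1 for i = b. The
    sum is read backwards, with l = b - i. *)
Lemma signed_hookE a b : (b <= k)%N ->
  (-1) ^+ b * schur_hook t a b =
  h (a + b%:Z) - \sum_(1 <= l < b.+1) (tc t l)%:~R * h (a + b%:Z - l%:Z).
Proof.
move=> bk; rewrite /schur_hook (reindex_inj rev_ord_inj) /= mulr_sumr.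
rewrite big_ord_recl /= subSS subn0 subnn /Defs.esym /= mulr1 mulrA -exprD.
rewrite addnn -mul2n exprM sqrrN !expr1n mul1r; congr (_ + _).
rewrite big_add1 big_mkord -sumrN; apply: eq_bigr => -[i ib] _ /=.
rewrite /bump /= add1n subSS (_ : b - (b - i.+1) = i.+1)%N; last by lia.
rewrite /Defs.esym /= (_ : (i.+1 <= k.+1)%N); last by lia.
rewrite (_ : a + (b - i.+1)%N%:Z = a + b%:Z - i.+1%:Z); last by lia.
have -> : (-1) ^+ b = (-1) ^+ (b - i.+1) * (-1) ^+ i.+1 :> rat.
  by rewrite -exprD; congr (_ ^+ _); lia.
rewrite -/h !exprS; set u := (-1) ^+ (b - _); set s := (-1) ^+ i.
set v := h _; set w := _%:~R.
transitivity (- (u ^+ 2 * s ^+ 2 * (w * v))); first by ring.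
by rewrite !sqrr_sign !mul1r.
Qed.

Hypothesis tk_neq0 : tc t k.+1 != 0.

(** As a function of a, a hook is a combination of shifts of h whose coefficients do not depend on
    a. *)
Lemma signed_hook_rec b : (b <= k)%N ->
  core_rec t (fun a => (-1) ^+ b * schur_hook t a b).
Proof.
move=> bk n; have hrec : core_rec t h by move=> m; exact: gfp_rec.
pose c (i : 'I_b.+1) := (-1) ^+ b * ((-1) ^+ i * Defs.esym t (b - i)).
have SE a : (-1) ^+ b * schur_hook t a b = \sum_i c i * h (a + i%:Z).
  rewrite mulr_sumr; apply: eq_bigr => i _.
  by rewrite [_ * gfp _ _ * _]mulrAC mulrA.
rewrite SE (core_rec_sum _ _ (fun i : 'I_b.+1 => core_rec_shift i%:Z hrec)).
by apply: eq_bigr => l _; rewrite SE.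
Qed.

Let M (n : int) : 'M[rat]_k.+1 := \matrix_(i, j)
  ((-1) ^+ (k - j) * schur_hook t (n - k.+1%:Z + i.+1%:Z) (k - j)).

Lemma hook_mx0 : M 0 = 1.
Proof.
apply/matrixP => i j; rewrite !mxE signed_hookE ?leq_subr //.
have := ltn_ord i; have := ltn_ord j; rewrite !ltnS => jk ik.
have hN (n : int) : - k%:Z <= n < 0 -> h n = 0.
  case: n => [m|m] nk; first by lia.
  by rewrite NegzE /h gfpN //; lia.
have [ij|ji] := leqP i j.
  rewrite big_nat big1 => [|l lb]; last by rewrite hN ?mulr0 //; lia.
  rewrite subr0; have [->|nij] := eqVneq i j.
    by rewrite (_ : _ + _ = 0) ?gfp0 //; lia.
  by rewrite hN //; move: nij; rewrite -val_eqE /=; lia.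
(* Below the diagonal, expanding h_(i-j) cancels the terms with l <= k - j; the remaining ones have
   index between -k and -1. *)
rewrite {1}/h gfp_rec // (big_cat_nat (n := (k - j).+1)) //=; last by lia.
rewrite addrAC subrr add0r big_nat big1 => [|l lb].
  by rewrite -val_eqE /= gtn_eqF.
by rewrite -/h hN ?mulr0 //; lia.
Qed.

Lemma hook_mxS n : M (n + 1) = companion t * M n.
Proof.
apply/matrixP => i j; rewrite !mxE.
pose x m := (-1) ^+ (k - j) * schur_hook t (n - k.+1%:Z + m.+1%:Z) (k - j).
transitivity (\sum_l idfun (companion t i l) * x l).
  (* Only the last row needs the recurrence; the others just raise a by 1. *)
  rewrite (companion_row_sum idfun); case: eqP => [ik|_].
    rewrite (signed_hook_rec (leq_subr _ _)) big_nat [RHS]big_nat.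
    apply: eq_bigr => l lk; congr (_ * (_ * schur_hook t _ _)); lia.
  by congr (_ * schur_hook t _ _); lia.
by apply: eq_bigr => l _; rewrite !mxE.
Qed.

Lemma companion_hook n (i j : 'I_k.+1) :
  (companion t ^ n) i j =
  (-1) ^+ (k - j) * schur_hook t (n - k.+1%:Z + i.+1%:Z) (k - j).
Proof.
have <- := exprz_uniq (companion_unit tk_neq0) hook_mx0 hook_mxS n.
by rewrite mxE.
Qed.

Lemma companion_rec (i j : 'I_k.+1) :
  core_rec t (fun n => (companion t ^ n) i j).
Proof.
move=> n; rewrite companion_hook -addrA.
have /(_ n) -> := core_rec_shift (- k.+1%:Z + i.+1%:Z)
  (signed_hook_rec (leq_subr j k)).
by apply: eq_bigr => l _; rewrite companion_hook addrA.
Qed.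

End HookEntries.

(** * Roots of the core polynomial and eigenvectors *)

Section Roots.

Variables (F : numFieldType) (k : nat) (t : k.+1.-tuple int).

Let coreF : {poly F} := map_poly intr (core_poly t).

Lemma map_core_polyE :
  coreF = 'X^(k.+1) - \sum_(1 <= l < k.+2) (tc t l)%:~R *: 'X^(k.+1 - l).
Proof.
rewrite /coreF rmorphB rmorph_sum /= map_polyXn; congr (_ - _).
by apply: eq_bigr => l _; rewrite map_polyZ /= map_polyXn.
Qed.

Lemma coef_map_core_poly j : (j <= k)%N -> coreF`_j = - (tc t (k.+1 - j))%:~R.
Proof.
move=> jk; rewrite map_core_polyE coefB coefXn ltn_eqF ?ltnS // sub0r coef_sum.
congr (- _); rewrite (bigD1_seq (k.+1 - j)%N) ?iota_uniq //=; last first.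
  by rewrite mem_index_iota; lia.
rewrite coefZ coefXn subKn ?eqxx ?mulr1; last by lia.
rewrite big_nat_cond big1 ?addr0 // => l /andP[lk nl].
by rewrite coefZ coefXn (_ : (_ == _) = false) ?mulr0 //; lia.
Qed.

Hypothesis tk_neq0 : tc t k.+1 != 0.

Lemma root_core_neq0 z : root coreF z -> z != 0.
Proof.
apply: contraTneq => ->; rewrite /root horner_coef0 coef_map_core_poly //.
by rewrite oppr_eq0 intr_eq0.
Qed.

Lemma root_core_expS z : root coreF z ->
  z ^+ k.+1 = \sum_(1 <= l < k.+2) (tc t l)%:~R * z ^+ (k.+1 - l).
Proof.
rewrite /root map_core_polyE hornerD hornerN hornerXn horner_sum subr_eq0.
by move/eqP->; apply: eq_bigr => l _; rewrite hornerZ hornerXn.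
Qed.

Lemma root_core_rec z : root coreF z -> core_rec t (fun n => z ^ n).
Proof.
move=> rz n; have z0 := root_core_neq0 rz.
rewrite -{1}(subrK k.+1%:Z n) expfzDr // -exprnP root_core_expS // mulr_sumr.
rewrite big_nat [RHS]big_nat; apply: eq_bigr => l lk.
by rewrite mulrCA exprnP -expfzDr //; congr (_ * z ^ _); lia.
Qed.

Let B : 'M[F]_k.+1 := map_mx ratr (companion t).

Lemma map_companion_exp n : map_mx ratr (companion t ^ n) = B ^ n.
Proof. by rewrite rmorphXz //; exact: companion_unit. Qed.

Lemma companion_eigen z n : root coreF z ->
  B ^ n *m (\col_j z ^+ j) = z ^ n *: (\col_j z ^+ j : 'cV_k.+1).
Proof.
move=> rz; have z0 := root_core_neq0 rz.
have uB : B \is a GRing.unit.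
  by apply: rmorph_unit; exact: companion_unit.
have BV : B *m (\col_j z ^+ j) = z *: (\col_j z ^+ j : 'cV_k.+1).
  apply/colP => i; rewrite !mxE.
  transitivity (\sum_j ratr (companion t i j) * z ^+ j).
    by apply: eq_bigr => j _; rewrite !mxE.
  rewrite (companion_row_sum ratr t (fun j => z ^+ j)) -exprS.
  by case: eqP => [[->]|//]; rewrite -root_core_expS.
elim/int_ind: n => [|n IHn|n IHn]; first by rewrite !expr0z mul1mx scale1r.
  by rewrite exprSzr -mulmxA BV -scalemxAr IHn scalerA -exprSz.
rewrite (_ : - n.+1%:Z = - n%:Z - 1); last by lia.
rewrite exprzDr // expfzDr // -mulmxA.
(* Negative powers: write the eigenvector v as z^(-1) (B v), then cancel B. *)
have -> : B ^ (-1) *m (\col_j z ^+ j) = z ^ (-1) *: (\col_j z ^+ j : 'cV_k.+1).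
  rewrite -[X in _ *m X](scalerK z0) -BV -scalemxAr mulmxA.
  by rewrite -!exprN1 (mulVmx uB) mul1mx.
by rewrite -scalemxAr IHn scalerA mulrC.
Qed.

End Roots.

(** * Trace of the powers through the Newton basis *)

(** Both claims go through one induction: in a diagonal entry of T T^n, triangularity of T kills the
    terms l < i and that of T^n those with l > i. *)
Lemma upper_trig_exp (R : pzRingType) (k : nat) (T : 'M[R]_k.+1) (n : nat) :
  (forall i j : 'I_k.+1, (j < i)%N -> T i j = 0) ->
  (forall i j : 'I_k.+1, (j < i)%N -> (T ^+ n) i j = 0) /\
  (forall i, (T ^+ n) i i = T i i ^+ n).
Proof.
move=> Ttrig; elim: n => [|n [IHt IHd]].
  split=> [i j ji|i]; rewrite expr0 !mxE ?eqxx //.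
  by rewrite -val_eqE gtn_eqF.
split=> [i j ji|i]; rewrite exprS !mxE.
  rewrite big1 // => l _; have [li|il] := ltnP l i.
    by rewrite Ttrig ?mul0r.
  by rewrite IHt ?mulr0 //; exact: leq_trans ji il.
rewrite (bigD1 i) //= IHd -exprS big1 ?addr0 // => l li.
have [li'|il] := ltnP l i; first by rewrite Ttrig ?mul0r.
by rewrite IHt ?mulr0 // ltn_neqAle il andbT eq_sym.
Qed.

Section Trace.

Variables (F : numFieldType) (k : nat) (t : k.+1.-tuple int).
Variable lam : 'I_k.+1 -> F.
Hypothesis lamP : roots_of t lam.

Lemma root_core_lam i : root (map_poly intr (core_poly t)) (lam i).
Proof.
rewrite lamP /root horner_prod; apply/prodf_eq0; exists i => //.
by rewrite hornerXsubC subrr.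
Qed.

Let newton (m : nat) : {poly F} :=
  \prod_(i < m) ('X - (lam (inord i))%:P).

Lemma newtonS m : newton m.+1 = newton m * 'X - lam (inord m) *: newton m.
Proof.
rewrite {1}/newton big_ord_recr /= -/(newton m) mulrBr -mul_polyC.
by rewrite [_%:P * _]mulrC.
Qed.

Lemma size_newton m : size (newton m) = m.+1.
Proof. by rewrite size_prod_XsubC /index_enum -enumT size_enum_ord. Qed.

Lemma newton_lead m : (newton m)`_m = 1.
Proof.
have /monicP := monic_prod_XsubC (index_enum 'I_m) xpredT
  (fun i => lam (inord i)).
by rewrite /lead_coef size_newton.
Qed.

Lemma newton_core : newton k.+1 = map_poly intr (core_poly t).
Proof. by rewrite lamP; apply: eq_bigr => i _; rewrite inord_val. Qed.

Let B : 'M[F]_k.+1 := map_mx ratr (companion t).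
Let P : 'M[F]_k.+1 := \matrix_(i, j) (newton i)`_j.
(** Row i encodes X N_i = lambda_i N_i + N_(i+1) for the Newton polynomials N_i; the last row stops
    at the diagonal because N_(k+1) is the core polynomial. *)
Let T : 'M[F]_k.+1 :=
  \matrix_(i, j) (lam i *+ (i == j) + (j == i.+1 :> nat)%:R).

Lemma newton_mx_unit : P \is a GRing.unit.
Proof.
rewrite -[_ \is a _]/(P \in unitmx) unitmxE det_trig; last first.
  by apply/is_trig_mxP => i j ij; rewrite mxE nth_default // size_newton.
by rewrite big1 ?unitr1 // => i _; rewrite mxE newton_lead.
Qed.

(* Multiplication by X modulo the core polynomial, in the monomial basis and
   in the Newton basis. *)
Lemma newton_mx_companion : P * B = T * P.
Proof.
apply/matrixP => i j; rewrite !mxE.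
under eq_bigr => l _ do rewrite !mxE.
under [RHS]eq_bigr => l _ do rewrite !mxE mulrDl.
rewrite big_split /= [X in _ = X + _](bigD1 i) //= eqxx mulr1n.
rewrite [X in _ = _ + X + _]big1 ?addr0 => [|l li]; last first.
  by rewrite eq_sym (negPf li) mul0r.
(* This is the coefficient of X^j in X N_i, after the overflow in X^(k+1) is replaced using the core
   polynomial. *)
have -> : \sum_(l < k.+1) (newton i)`_l *
    ratr (if l.+1 == k.+1 then (tc t (k.+1 - j))%:~R else (j == l.+1 :> nat)%:R)
  = (newton i * 'X)`_j + (newton i)`_k * (tc t (k.+1 - j))%:~R.
  rewrite big_ord_recr /= eqxx ratr_int coefMX; congr (_ + _).
  case: (posnP j) => [j0|j0].
    by rewrite big1 // => l _; rewrite j0 ltn_eqF ?ltnS // rmorph0 mulr0.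
  have jk : (j.-1 < k)%N by have := ltn_ord j; lia.
  rewrite (bigD1 (Ordinal jk)) //= prednK // eqxx ltn_eqF; last by lia.
  rewrite rmorph1 mulr1 big1 ?addr0 // => l; rewrite -val_eqE /= => lj.
  rewrite ltn_eqF ?ltnS // (_ : (_ == _) = false) ?rmorph0 ?mulr0 //; lia.
have XE : newton i * 'X = newton i.+1 + lam i *: newton i.
  by rewrite newtonS inord_val subrK.
rewrite XE coefD coefZ [_`_j + _]addrC -addrA; congr (_ + _).
(* Overflow occurs only for i = k, where it cancels against the coefficient -t_(k+1-j) of
   N_(k+1). *)
have := ltn_ord i; rewrite ltnS leq_eqVlt => /predU1P[ik|ik].
  rewrite ik newton_lead newton_core coef_map_core_poly ?mul1r ?addNr; last first.
    by rewrite -ltnS.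
  by rewrite big1 // => l _; rewrite ltn_eqF ?mul0r.
rewrite [(newton i)`_k]nth_default ?size_newton // mul0r addr0.
rewrite (bigD1 (Ordinal (ik : i.+1 < k.+1)%N)) //= eqxx mul1r big1 ?addr0 //.
by move=> l; rewrite -val_eqE /= => /negPf ->; rewrite mul0r.
Qed.

Lemma trace_companion_nat (n : nat) : \tr (B ^+ n) = lucas lam n.
Proof.
have PB : P * B ^+ n = T ^+ n * P.
  elim: n => [|n IHn]; first by rewrite mulr1 mul1r.
  by rewrite !exprS mulrA newton_mx_companion -mulrA IHn mulrA.
have -> : B ^+ n = P^-1 * (T ^+ n * P) by rewrite -PB mulKr // newton_mx_unit.
rewrite mxtrace_mulC -[_ *m _]/(T ^+ n * P / P) mulrK ?newton_mx_unit //.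
have Ttrig (i j : 'I_k.+1) : (j < i)%N -> T i j = 0.
  move=> ji; rewrite mxE -val_eqE gtn_eqF // ltn_eqF ?addr0 //.
  exact: ltn_trans ji _.
apply: eq_bigr => i _; rewrite (upper_trig_exp n Ttrig).2 mxE eqxx.
by rewrite ltn_eqF // addr0.
Qed.

Hypothesis tk_neq0 : tc t k.+1 != 0.

Lemma lucas_rec : core_rec t (lucas lam).
Proof.
have /(_ F k.+1 t) H := core_rec_sum; move=> n; rewrite /lucas.
(* Unit coefficients bring the power sum to the shape of [core_rec_sum]. *)
under eq_bigr => i _ do rewrite -[_ ^ n]mul1r.
rewrite (H _ _ (fun=> 1) _ (fun i => root_core_rec tk_neq0 (root_core_lam i))).
by apply: eq_bigr => l _; congr (_ * _); apply: eq_bigr => i _; rewrite mul1r.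
Qed.

Lemma trace_companion_rec :
  core_rec t (fun n => ratr (\tr (companion t ^ n)) : F).
Proof.
pose x (i : 'I_k.+1) n : F := ratr ((companion t ^ n) i i).
have trE n : ratr (\tr (companion t ^ n)) = \sum_i 1 * x i n.
  by rewrite rmorph_sum; apply: eq_bigr => i _; rewrite mul1r.
have xrec i : core_rec t (x i).
  move=> n; rewrite /x companion_rec // rmorph_sum.
  by apply: eq_bigr => l _; rewrite rmorphM /= ratr_int.
move=> n; rewrite trE (core_rec_sum _ _ xrec).
by apply: eq_bigr => l _; rewrite -trE.
Qed.

Lemma trace_companion n : ratr (\tr (companion t ^ n)) = lucas lam n.
Proof.
pose x m : F := ratr (\tr (companion t ^ m)) - lucas lam m.
suff : x n = 0 by move/eqP; rewrite subr_eq0 => /eqP.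
have tkF : (tc t k.+1)%:~R != 0 :> F by rewrite intr_eq0.
move: n; apply: (core_rec_eq0 tkF) => [n|n]; last first.
  apply/eqP; rewrite subr_eq0 -trace_map_mx map_companion_exp //.
  by apply/eqP; exact: trace_companion_nat.
rewrite /x {1}trace_companion_rec {1}lucas_rec -sumrB.
by apply: eq_bigr => l _; rewrite mulrBr.
Qed.

End Trace.

(* The order k >= 1 is k.+1, and the row and column indices i, j >= 1 are
   i.+1, j.+1. *)
Theorem theorem3p1 (R : realType) (k : nat) (t : k.+1.-tuple int)
    (tk_neq0 : tc t k.+1 != 0) :
  [/\
   (* (a) *)
   forall (n : int) (i j : 'I_k.+1),
     (companion t ^ n) i j =
     (-1) ^+ (k.+1 - j.+1)
       * schur_hook t (n - k.+1%:Z + i.+1%:Z) (k.+1 - j.+1),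
   (* (b) *)
   forall (lambda : R[i]) (m : int),
     root (map_poly intr (core_poly t)) lambda ->
     lambda ^ m =
     \sum_(j < k.+1)
        ratr ((-1) ^+ (k.+1 - 1 - j)
                * schur_hook t (m - k.+1%:Z + 1) (k.+1 - 1 - j)) * lambda ^+ j,
   (* (c) *)
   (forall (i j : 'I_k.+1) (n : int),
      (companion t ^ n) i j =
      \sum_(1 <= l < k.+2) (tc t l)%:~R * (companion t ^ (n - l%:Z)) i j) /\
   (forall n : int, (companion t ^ n) ord_max ord_max = gfp t n) &
   (* (d) *)
   forall lam : 'I_k.+1 -> R[i], roots_of t lam ->
     (forall n : int, ratr (\tr (companion t ^ n)) = lucas lam n) /\
     (forall n : int,
        lucas lam n =
        \sum_(1 <= l < k.+2) (tc t l)%:~R * lucas lam (n - l%:Z))].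
Proof.
split=> [n i j|z m rz||lam lamP].
- by rewrite subSS companion_hook.
- have := congr1 (fun V : 'cV_k.+1 => V ord0 ord0)
    (companion_eigen tk_neq0 m rz).
  rewrite !mxE expr0 mulr1 => <-; apply: eq_bigr => j _.
  by rewrite -map_companion_exp // !mxE companion_hook // subn1.
- split=> [i j|n]; first exact: companion_rec.
  (* The last diagonal entry is the hook with a = n and b = 0, whose only term is h_n e_0. *)
  rewrite companion_hook // subnn expr0 mul1r subrK /schur_hook big_ord1.
  by rewrite expr0 mul1r addr0 mulr1.
- by split=> [n|]; [exact: trace_companion | exact: lucas_rec].
Qed.
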